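(* There is a universal constant $c_0>0$ such that for all universal constants $0<c_2\le c_1\le c_0$ there exists a universal constant $c_3>0$ such that the following holds. Let $\delta\in(0,1)$, $\gamma\in(0,1)$ and $\varepsilon\in\big(0,\frac{1}{1-\gamma}\big]$. Suppose the learning rates satisfy, for all $0\le t\le T$, $\frac{1}{1+c_1(1-\gamma)T/\log^2 T}\le \eta_t\le \frac{1}{1+c_2(1-\gamma)t/\log^2 T}$, and $$T\ge \frac{c_3(\log^3 T)\,\log\frac{|\mathcal S|T}{\delta}}{\gamma^2(1-\gamma)^3\min\{\varepsilon,\varepsilon^2\}}.$$ If $0\le V_0(s)\le\frac{1}{1-\gamma}$ for all $s$, then with probability at least $1-\delta$, synchronous TD learning satisfies $\max_{s\in\mathcal S}|V_T(s)-V^\star(s)|\le\varepsilon$.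
   Context: A Markov reward process (MRP) consists of a finite state space $\mathcal S$, a transition kernel $P:\mathcal S\to\Delta(\mathcal S)$, a reward function $r:\mathcal S\to[0,1]$ and a discount factor $\gamma\in(0,1)$. Its value function is $V^\star(s)=\mathbb E\big[\sum_{k\ge0}\gamma^k r(s_k)\mid s_0=s\big]$ where $s_{k+1}\sim P(\cdot\mid s_k)$. Synchronous TD learning: in each iteration $t=1,\dots,T$, for every $s\in\mathcal S$ an independent sample $s_t(s)\sim P(\cdot\mid s)$ is drawn (independent across states and iterations), and $V_t(s)=(1-\eta_t)V_{t-1}(s)+\eta_t\big(r(s)+\gamma V_{t-1}(s_t(s))\big)$, with learning rates $\eta_t\in(0,1]$. Logarithms are natural. *)

(* Defs.v *)
From HB Require Import structures.
From mathcomp Require Import all_boot all_order all_algebra.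
From mathcomp Require Import all_classical all_reals all_analysis.
Set Implicit Arguments. Unset Strict Implicit. Unset Printing Implicit Defensive.
Import Order.TTheory GRing.Theory Num.Theory.
Local Open Scope ring_scope.

Section MRP.
Variables (R : realType) (S : finType).

Definition is_kernel (P : S -> S -> R) : Prop :=
  (forall s s', 0 <= P s s') /\ (forall s, \sum_(s' : S) P s s' = 1).

Definition Pop (P : S -> S -> R) (f : S -> R) : S -> R :=
  fun s => \sum_(s' : S) P s s' * f s'.

(* V*(s) = sum_k gamma^k E[r(s_k) | s_0 = s], with E[r(s_k)|s_0=s] = (P^k r)(s) *)
Definition Vstar (P : S -> S -> R) (r : S -> R) (gamma : R) (s : S) : R :=
  limn (fun n => \sum_(0 <= k < n) gamma ^+ k * iter k (Pop P) r s).

(* Synchronous TD: sigma t' s is the sample s_{t'+1}(s) used at iteration t'+1. *)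
Fixpoint td (r : S -> R) (gamma : R) (eta : nat -> R) (sigma : nat -> S -> S)
    (V0 : S -> R) (t : nat) : S -> R :=
  match t with
  | 0 => V0
  | t'.+1 => fun s =>
      (1 - eta t) * td r gamma eta sigma V0 t' s
      + eta t * (r s + gamma * td r gamma eta sigma V0 t' (sigma t' s))
  end.

(* Sample space for T iterations: omega t s = sample drawn at iteration t+1 for state s. *)
Definition sample_space (T : nat) := {ffun 'I_T -> {ffun S -> S}}.

(* product weight: independent draws s_t(s) ~ P(.|s) across states and iterations *)
Definition weight (P : S -> S -> R) (T : nat) (w : sample_space T) : R :=
  \prod_(t < T) \prod_(s : S) P s (w t s).

Definition samples (T : nat) (w : sample_space T) : nat -> S -> S :=
  fun t s => odflt s (omap (fun i : 'I_T => w i s) (insub t)).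

Definition prob (P : S -> S -> R) (T : nat) (E : pred (sample_space T)) : R :=
  \sum_(w : sample_space T | E w) weight P w.

End MRP.

(* Main.v *)
Require Import Defs.
From HB Require Import structures.
From mathcomp Require Import all_boot all_order all_algebra.
From mathcomp Require Import all_classical all_reals all_analysis.
From mathcomp Require Import zify ring lra.
Import Order.TTheory GRing.Theory Num.Theory.
Local Open Scope ring_scope.
Set Implicit Arguments. Unset Strict Implicit. Unset Printing Implicit Defensive.

(** The error [Delta_t = V_t - V*] obeys the linear recursion
    [Delta_t = (1 - eta_t) Delta_(t-1) + eta_t gamma P Delta_(t-1) + noise].
    For a nonnegative row vector [p], conditioning on the past replaces
    [E exp (lam p . Delta_t)] by the same quantity at time [t - 1] for the row
    vector [(1 - eta_t) p + eta_t gamma p P], times the exponential of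
    [2 lam ^ 2 eta_t ^ 2 gamma ^ 2 sum_s p_s ^ 2 Var_s(V_(t-1))].  As long as
    [|Delta_(t-1)| <= B], that variance is at most [2 Var(V* ) + 2 B ^ 2], and a
    function [W = O((1 - gamma) ^ -2 + B ^ 2 / (1 - gamma))] with
    [W - gamma P W >= gamma ^ 2 (2 Var(V* ) + 2 B ^ 2)] makes the variances
    telescope.  Let [M = min(eps, eps ^ 2)].  A first round, started at time
    [T/3], uses the trivial [B = 1 / (1 - gamma)] and gives
    [|Delta_t| <= sqrt (M / (1 - gamma))] for all [t >= 2T/3]; a second round,
    over the last third, starts from this improved [B] and gives
    [|Delta_T| <= eps].  In each round the step sizes are large enough to contract
    the initial error by a factor [1 / T]. *)

(** * Averages and variances under a transition kernel *)

Section Averages.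
Variables (R : realType) (S : finType).
Implicit Types (P : S -> S -> R) (f g p : S -> R).

(** From [1 - x <= expR (- x)], [expR x] is at most [1 / (1 - x)], and [(1 - x) (1 + x + 2 x ^ 2) =
    1 + x ^ 2 (1 - 2 x)] is at least 1. *)
Lemma expR_le_quadratic (x : R) : x <= 1 / 2 -> expR x <= 1 + x + 2 * x ^+ 2.
Proof.
move=> hx; have h1 : 0 < 1 - x by lra.
have -> : expR x = (expR (- x))^-1 by rewrite expRN invrK.
have h2 : 1 - x <= expR (- x) by exact: expR_ge1Dx.
apply: (@le_trans _ _ (1 - x)^-1); first by rewrite lef_pV2 ?posrE ?expR_gt0.
rewrite -div1r ler_pdivrMr //.
have : 0 <= x ^+ 2 * (1 - 2 * x) by rewrite mulr_ge0 ?sqr_ge0//; lra.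
by nra.
Qed.

(** In the quadratic bound for [expR (f s)] the linear term averages to zero; [1 + y <= expR y] puts
    the remainder back into an exponential. *)
Lemma mgf_centered_le p f : (forall s, 0 <= p s) -> \sum_s p s = 1 ->
  \sum_s p s * f s = 0 -> (forall s, f s <= 1 / 2) ->
  \sum_s p s * expR (f s) <= expR (2 * \sum_s p s * f s ^+ 2).
Proof.
move=> p0 p1 pf f2; apply: le_trans (expR_ge1Dx _).
apply: (@le_trans _ _ (\sum_s p s * (1 + f s + 2 * f s ^+ 2))).
  by apply: ler_sum => s _; rewrite ler_wpM2l// expR_le_quadratic.
rewrite (eq_bigr (fun s => p s + (p s * f s + 2 * (p s * f s ^+ 2)))); last first.
  by move=> s _; ring.
by rewrite !big_split /= p1 pf add0r -mulr_sumr.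
Qed.

Lemma Pop_ge0 P f s : is_kernel P -> (forall s, 0 <= f s) -> 0 <= Pop P f s.
Proof. by move=> [P0 _] f0; apply: sumr_ge0 => s' _; rewrite mulr_ge0. Qed.

Lemma Pop_le P f g s : is_kernel P -> (forall s, f s <= g s) ->
  Pop P f s <= Pop P g s.
Proof. by move=> [P0 _] fg; apply: ler_sum => s' _; rewrite ler_wpM2l. Qed.

Lemma PopD P f g s : Pop P (fun s => f s + g s) s = Pop P f s + Pop P g s.
Proof. by rewrite /Pop -big_split /=; apply: eq_bigr => s' _; rewrite mulrDr. Qed.

Lemma PopZ P a f s : Pop P (fun s => a * f s) s = a * Pop P f s.
Proof. by rewrite /Pop mulr_sumr; apply: eq_bigr => s' _; ring. Qed.

Lemma Pop_cst P a s : is_kernel P -> Pop P (fun=> a) s = a.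
Proof. by move=> [_ P1]; rewrite /Pop -mulr_suml P1 mul1r. Qed.

Lemma eq_Pop P f g s : f =1 g -> Pop P f s = Pop P g s.
Proof. by move=> fg; apply: eq_bigr => s' _; rewrite fg. Qed.

Definition Pvar P f s : R := Pop P (fun s' => (f s' - Pop P f s) ^+ 2) s.

Lemma PvarE P f s : is_kernel P ->
  Pvar P f s = Pop P (fun s => f s ^+ 2) s - Pop P f s ^+ 2.
Proof.
move=> kP; set m := Pop P f s.
rewrite /Pvar -/m (@eq_Pop _ _ (fun s' => f s' ^+ 2 + ((- (2 * m)) * f s' + m ^+ 2))).
  by rewrite !PopD PopZ Pop_cst // -/m; ring.
by move=> s'; ring.
Qed.

Lemma PvarD_le P f g s : is_kernel P ->
  Pvar P (fun s => f s + g s) s <= 2 * Pvar P f s + 2 * Pvar P g s.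
Proof.
move=> kP; rewrite /Pvar -!PopZ -PopD PopD; apply: Pop_le => // s'.
set a := Pop P f s; set b := Pop P g s.
have := sqr_ge0 ((f s' - a) - (g s' - b)); nra.
Qed.

Lemma Pvar_le P f s d : is_kernel P -> (forall s, `|f s| <= d) ->
  Pvar P f s <= d ^+ 2.
Proof.
move=> kP fd; rewrite PvarE //.
have : Pop P (fun s => f s ^+ 2) s <= Pop P (fun=> d ^+ 2) s.
  apply: Pop_le => // s'; rewrite -[_ ^+ 2]ger0_norm ?sqr_ge0// normrX.
  by rewrite lerXn2r ?nnegrE // (le_trans _ (fd s')).
rewrite Pop_cst //; have := sqr_ge0 (Pop P f s); lra.
Qed.

End Averages.

(** * Range and Bellman equation of the value function *)

Section ValueFunction.
Import numFieldNormedType.Exports.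
Local Open Scope classical_set_scope.
Variables (R : realType) (S : finType) (P : S -> S -> R) (r : S -> R) (gamma : R).
Hypotheses (kP : is_kernel P) (hr : forall s, 0 <= r s <= 1).
Hypotheses (g0 : 0 < gamma) (g1 : gamma < 1).

Let u n s := \sum_(0 <= k < n) gamma ^+ k * iter k (Pop P) r s.

(** Peeling off the term [k = 0] shows that the partial sums are the Bellman iterates started from
    0. *)
Let uS n s : u n.+1 s = r s + gamma * Pop P (u n) s.
Proof.
rewrite /u big_nat_recl //= expr0 mul1r; congr (_ + _).
rewrite /Pop [in RHS](eq_bigr (fun s' => \sum_(0 <= k < n)
  P s s' * (gamma ^+ k * iter k (Pop P) r s'))); last by move=> *; rewrite mulr_sumr.
rewrite exchange_big mulr_sumr; apply: eq_bigr => k _ /=.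
by rewrite /Pop !mulr_sumr; apply: eq_bigr => s' _; rewrite exprS; ring.
Qed.

Let u_bound n s : 0 <= u n s <= 1 / (1 - gamma).
Proof.
have g1' : 0 < 1 - gamma by rewrite subr_gt0.
elim: n s => [|n IH] s.
  by rewrite /u big_geq // lexx /= divr_ge0 // ltW.
rewrite uS; have [r0 r1] := andP (hr s).
have h0 : 0 <= Pop P (u n) s by apply: Pop_ge0 => // s'; case/andP: (IH s').
have h1 : Pop P (u n) s <= 1 / (1 - gamma).
  rewrite -[leRHS](@Pop_cst _ _ P _ s kP); apply: Pop_le => // s'.
  by case/andP: (IH s').
apply/andP; split; first by apply: addr_ge0 => //; apply: mulr_ge0 => //; exact: ltW.
(* [1 / (1 - gamma)] is the fixed point of [x -> 1 + gamma x], so the induction bound reproduces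
   itself. *)
have e : 1 + gamma * (1 / (1 - gamma)) = 1 / (1 - gamma) by field; exact: lt0r_neq0.
rewrite -[leRHS]e lerD //; by apply: ler_wpM2l => //; exact: ltW.
Qed.

Let iter_Pop_ge0 k s : 0 <= iter k (Pop P) r s.
Proof.
elim: k s => [|k IH] s /=; first by case/andP: (hr s).
exact: Pop_ge0.
Qed.

Let u_cvg s : cvgn (u^~ s).
Proof.
apply: nondecreasing_is_cvgn.
  apply/nondecreasing_seqP => n; rewrite /u big_nat_recr //= lerDl.
  by rewrite mulr_ge0 ?exprn_ge0 // ltW.
exists (1 / (1 - gamma)) => _ [n _ <-]; by case/andP: (u_bound n s).
Qed.

Lemma Vstar_bound s : 0 <= Vstar P r gamma s <= 1 / (1 - gamma).
Proof.
apply/andP; split.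
  apply: limr_ge; first exact: u_cvg.
  by near=> n; case/andP: (u_bound n s).
apply: limr_le; first exact: u_cvg.
by near=> n; case/andP: (u_bound n s).
Unshelve. all: by end_near.
Qed.

(** Limit of the recursion for the partial sums; averaging under [P] is a finite sum and commutes
    with the limit. *)
Lemma Vstar_Bellman s :
  Vstar P r gamma s = r s + gamma * Pop P (Vstar P r gamma) s.
Proof.
have h1 : (fun n => u n.+1 s) @ \oo --> Vstar P r gamma s.
  by rewrite (cvg_shiftS (u^~ s)); exact: u_cvg.
suff h2 : (fun n => u n.+1 s) @ \oo --> r s + gamma * Pop P (Vstar P r gamma) s.
  by rewrite -[LHS](cvg_lim _ h1) // (cvg_lim _ h2).
rewrite [X in X @ _](_ : _ = (fun n => r s + gamma * Pop P (u n) s)); last first.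
  by apply/funext => n; rewrite uS.
apply: cvgD; first exact: cvg_cst.
apply: cvgM; first exact: cvg_cst.
rewrite /Pop.
apply: cvg_big => [|s' _]; first by apply: add_continuous.
by apply: cvgM; [exact: cvg_cst | exact: u_cvg].
Qed.

End ValueFunction.

(** * Expectation over the samples and resampling of one iteration *)

Section Expectation.
Variables (R : realType) (S : finType) (P : S -> S -> R) (T : nat).
Hypothesis kP : is_kernel P.
Implicit Types (w : sample_space S T) (F G : sample_space S T -> R).

Definition step_weight (x : {ffun S -> S}) : R := \prod_s P s (x s).

Lemma step_weight_ge0 x : 0 <= step_weight x.
Proof. by apply: prodr_ge0 => s _; case: kP. Qed.

(** Independence across states: the product weight factorizes by distributivity. *)
Lemma step_weight_prod (h : S -> S -> R) :
  \sum_x step_weight x * (\prod_s h s (x s)) = \prod_s \sum_s' P s s' * h s s'.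
Proof.
rewrite bigA_distr_bigA /=; apply: eq_bigr => x _.
by rewrite /step_weight -big_split.
Qed.

Lemma step_weight_sum : \sum_x step_weight x = 1.
Proof.
rewrite /step_weight -(@bigA_distr_bigA _ _ _ _ _ _ _ P) big1 // => s _.
by case: kP.
Qed.

Lemma weight_ge0 w : 0 <= weight P w.
Proof. by apply: prodr_ge0 => t _; exact: step_weight_ge0. Qed.

Lemma weight_sum : \sum_(w : sample_space S T) weight P w = 1.
Proof.
rewrite /weight -(@bigA_distr_bigA _ _ _ _ _ 'I_T _ (fun=> step_weight)).
by rewrite big1 // => t _; exact: step_weight_sum.
Qed.

Definition mean F : R := \sum_w weight P w * F w.

Lemma mean_le F G : (forall w, F w <= G w) -> mean F <= mean G.
Proof. by move=> FG; apply: ler_sum => w _; rewrite ler_wpM2l // weight_ge0. Qed.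

Lemma meanZr F a : mean (fun w => F w * a) = mean F * a.
Proof. by rewrite /mean mulr_suml; apply: eq_bigr => w _; rewrite mulrA. Qed.

Lemma mean_cst a : mean (fun=> a) = a.
Proof. by rewrite /mean -mulr_suml weight_sum mul1r. Qed.

Lemma prob_mean (E : pred (sample_space S T)) : prob P E = mean (fun w => (E w)%:R).
Proof.
rewrite /prob big_mkcond /=; apply: eq_bigr => w _.
by case: (E w); rewrite ?mulr1 ?mulr0.
Qed.

Definition resample (t : 'I_T) (x : {ffun S -> S}) w : sample_space S T :=
  [ffun i => if i == t then x else w i].

(** Stands in for conditioning on the other iterations. Swapping coordinate [t] with an independent
    fresh copy is an involution ([sw]) that preserves the product weight. *)
Lemma mean_resample (t : 'I_T) F :
  mean F = mean (fun w => \sum_x step_weight x * F (resample t x w)).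
Proof.
pose sw (c : sample_space S T * {ffun S -> S}) := (resample t c.2 c.1, c.1 t).
have swK : involutive sw.
  case=> w x; rewrite /sw /= /resample ffunE eqxx; congr (_, _).
  by apply/ffunP => i; rewrite !ffunE; case: eqP => [->|].
have wsw c : weight P (sw c).1 * step_weight (sw c).2 = weight P c.1 * step_weight c.2.
  case: c => w x /=; rewrite /weight [in LHS](bigD1 t) //= [in RHS](bigD1 t) //=.
  rewrite (eq_bigr (fun i => \prod_s P s (w i s))).
    by rewrite /step_weight ffunE eqxx; ring.
  by move=> i /negPf it; apply: eq_bigr => s _; rewrite ffunE it.
transitivity (\sum_(c : sample_space S T * {ffun S -> S})
   weight P c.1 * step_weight c.2 * F c.1).
  rewrite -(pair_bigA _ (fun w x => weight P w * step_weight x * F w)) /=.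
  apply: eq_bigr => w _; rewrite -!mulr_suml -mulr_sumr step_weight_sum.
  by rewrite mulr1.
rewrite (reindex_inj (inv_inj swK)) /=.
under eq_bigr => c _ do rewrite (wsw c).
rewrite -(pair_bigA _ (fun w x => weight P w * step_weight x * F (resample t x w))) /=.
by apply: eq_bigr => w _; rewrite mulr_sumr; apply: eq_bigr => x _; rewrite mulrA.
Qed.

Lemma samples_ord w (t : 'I_T) s : samples w t s = w t s.
Proof. by rewrite /samples valK. Qed.

Lemma samples_resample_lt w (t : 'I_T) x k :
  (k < t)%N -> samples (resample t x w) k =1 samples w k.
Proof.
move=> kt s; have kT := ltn_trans kt (ltn_ord t).
have := samples_ord (resample t x w) (Ordinal kT) s => /= ->.
have := samples_ord w (Ordinal kT) s => /= ->.
by rewrite ffunE -val_eqE /= ltn_eqF.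
Qed.

Lemma eq_td (r : S -> R) gamma eta (sg sg' : nat -> S -> S) V0 t :
  (forall k, (k < t)%N -> sg k =1 sg' k) ->
  td r gamma eta sg V0 t =1 td r gamma eta sg' V0 t.
Proof.
elim: t => [//|t IH] h s /=.
have {}IH := IH (fun k kt => h k (ltnW kt)).
by rewrite h // !IH.
Qed.

(** Coordinate [t] is first read at iteration [t + 1], hence the non-strict bound on [k]. *)
Lemma td_resample (r : S -> R) gamma eta w (t : 'I_T) x V0 k : (k <= t)%N ->
  td r gamma eta (samples (resample t x w)) V0 k =1 td r gamma eta (samples w) V0 k.
Proof.
by move=> kt; apply: eq_td => j jk; apply: samples_resample_lt; apply: leq_trans kt.
Qed.

End Expectation.

(** * Exponential moment of the noise of one iteration *)

Lemma Pvar_ge0 (R : realType) (S : finType) (P : S -> S -> R) f s : is_kernel P -> 0 <= Pvar P f s.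
Proof. by move=> kP; apply: Pop_ge0 => // s'; exact: sqr_ge0. Qed.

(** Independence across states splits the exponential into factors, each covered by the centered
    bound; the variances then add up. *)
Lemma step_mgf_le (R : realType) (S : finType) (P : S -> S -> R) (a V : S -> R) :
  is_kernel P -> (forall s s', a s * (V s' - Pop P V s) <= 1 / 2) ->
  \sum_x step_weight P x * expR (\sum_s a s * (V (x s) - Pop P V s)) <=
  expR (2 * \sum_s a s ^+ 2 * Pvar P V s).
Proof.
move=> kP ha.
under eq_bigr do rewrite expR_sum.
rewrite (step_weight_prod P (fun s s' => expR (a s * (V s' - Pop P V s)))).
rewrite mulr_sumr expR_sum; apply: ler_prod => s _.
have [P0 P1] := kP.
apply/andP; split; first by apply: sumr_ge0 => s' _; rewrite mulr_ge0 // expR_ge0.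
apply: le_trans (mgf_centered_le (P0 s) (P1 s) _ (ha s)) _.
  rewrite (eq_bigr (fun s' => a s * (P s s' * V s' - P s s' * Pop P V s))).
    by rewrite -mulr_sumr big_split /= sumrN -mulr_suml P1 mul1r subrr mulr0.
  by move=> s' _; ring.
rewrite ler_expR ler_pM2l // /Pvar /Pop mulr_sumr.
by apply: ler_sum => s' _; rewrite exprMn mulrCA.
Qed.

(** * The function that pays for the variances *)

Section VarianceBudget.
Variables (R : realType) (S : finType) (P : S -> S -> R) (r : S -> R) (gamma B : R).
Hypotheses (kP : is_kernel P) (hr : forall s, 0 <= r s <= 1).
Hypotheses (g0 : 0 < gamma) (g1 : gamma < 1).
Let Vs := Vstar P r gamma.

(** The [W] of the overview. The quadratic part pays for the variance of the value function; the
    constant part has drift exactly [2 B ^ 2] and pays for that of the error. *)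
Definition budget s : R :=
  2 * (Vs s * (2 / (1 - gamma) - Vs s)) + 2 * B ^+ 2 / (1 - gamma).

(** With [h = 1 / (1 - gamma)], completing the square gives [v (2 h - v) = h ^ 2 - (h - v) ^ 2]. *)
Lemma budget_bound s :
  0 <= budget s <= 2 / (1 - gamma) ^+ 2 + 2 * B ^+ 2 / (1 - gamma).
Proof.
have [h0 h1] := andP (Vstar_bound kP hr g0 g1 s).
have gi : 0 < (1 - gamma)^-1 by rewrite invr_gt0 subr_gt0.
rewrite /budget /Vs -exprVn; move: h0 h1 gi; rewrite div1r.
set v := Vstar _ _ _ _; set h := _^-1 => h0 h1 gi.
have hB : 0 <= 2 * B ^+ 2 * h by rewrite mulr_ge0 ?(ltW gi)// mulr_ge0 ?sqr_ge0.
have hv : 0 <= v * (2 * h - v) by apply: mulr_ge0 => //; lra.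
have hs := sqr_ge0 (h - v).
apply/andP; split; first lra.
nra.
Qed.

(* V - gamma P V = r turns the quadratic 2 V / (1 - gamma) - V ^ 2 into a
   supersolution of the Poisson equation whose source is gamma ^ 2 Var_P(V): this
   is the total-variance identity behind the (1 - gamma) ^ -3 rate. *)
Lemma budget_drift s :
  gamma ^+ 2 * (2 * Pvar P Vs s + 2 * B ^+ 2) <=
  budget s - gamma * Pop P budget s.
Proof.
have [h0 h1] := andP (Vstar_bound kP hr g0 g1 s).
have [r0 r1] := andP (hr s).
have eB : Vs s = r s + gamma * Pop P Vs s := Vstar_Bellman kP hr g0 g1 s.
have gi : 0 < 1 - gamma by rewrite subr_gt0.
have eP : Pop P budget s = (4 / (1 - gamma)) * Pop P Vs s
   + ((- 2) * Pop P (fun s => Vs s ^+ 2) s + 2 * B ^+ 2 / (1 - gamma)).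
  rewrite -!PopZ -[X in _ + (_ + X)](@Pop_cst _ _ P _ s kP) -!PopD.
  by apply: eq_Pop => s'; rewrite /budget; ring.
have Q0 : 0 <= Pop P (fun s => Vs s ^+ 2) s by apply: Pop_ge0 => // ?; exact: sqr_ge0.
have poisson (v y q x : R) : v = x + gamma * y -> 0 <= q -> 0 <= x ->
  v <= 1 / (1 - gamma) ->
  gamma ^+ 2 * (2 * (q - y ^+ 2) + 2 * B ^+ 2) <=
  2 * (v * (2 / (1 - gamma) - v)) + 2 * B ^+ 2 / (1 - gamma) -
   gamma * (4 / (1 - gamma) * y + (-2 * q + 2 * B ^+ 2 / (1 - gamma))).
  move=> ev q0 x0 v1.
  have -> : 2 * (v * (2 / (1 - gamma) - v)) + 2 * B ^+ 2 / (1 - gamma) -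
     gamma * (4 / (1 - gamma) * y + (-2 * q + 2 * B ^+ 2 / (1 - gamma))) =
     4 * (v - gamma * y) * (1 / (1 - gamma)) - 2 * v ^+ 2 + 2 * gamma * q + 2 * B ^+ 2.
    by field; exact: lt0r_neq0.
  have -> : gamma ^+ 2 * (2 * (q - y ^+ 2) + 2 * B ^+ 2) =
     2 * gamma ^+ 2 * q - 2 * (gamma * y) ^+ 2 + 2 * gamma ^+ 2 * B ^+ 2 by ring.
  have ey : gamma * y = v - x by rewrite ev; ring.
  rewrite ey.
  (* The right side minus the left side equals [4 k1 + 2 k2 + 2 k3 + 2 k4], where [k1] to [k4]
     denote the four nonnegative quantities below. *)
  have k1 : 0 <= x * (1 / (1 - gamma) - v) by apply: mulr_ge0 => //; lra.
  have k2 : 0 <= gamma * (1 - gamma) * q by rewrite !mulr_ge0 // ltW.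
  have k3 : 0 <= (1 - gamma) * (1 + gamma) * B ^+ 2.
    by rewrite mulr_ge0 ?sqr_ge0 // mulr_ge0 ?(ltW gi) // addr_ge0 // ltW.
  have k4 := sqr_ge0 x.
  nra.
rewrite eP PvarE //.
exact: (poisson (Vs s) (Pop P Vs s) (Pop P (fun s0 => Vs s0 ^+ 2) s) (r s) eB Q0 r0 h1).
Qed.

End VarianceBudget.

(** * Error recursion, its adjoint, and tail bounds for the error *)

Section TailBound.
Variables (R : realType) (S : finType) (P : S -> S -> R) (r V0 : S -> R).
Variables (gamma : R) (eta : nat -> R) (T : nat).
Hypotheses (kP : is_kernel P) (hr : forall s, 0 <= r s <= 1).
Hypotheses (g0 : 0 < gamma) (g1 : gamma < 1).
Hypothesis (hV0 : forall s, 0 <= V0 s <= 1 / (1 - gamma)).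
Hypothesis (heta : forall t, (0 < t <= T)%N -> 0 <= eta t <= 1).
Implicit Types (w : sample_space S T) (p : S -> R).

Let V w t := td r gamma eta (samples w) V0 t.
Let Vs := Vstar P r gamma.

Definition td_error w t s : R := V w t s - Vs s.

Lemma td_bound w t s : (t <= T)%N -> 0 <= V w t s <= 1 / (1 - gamma).
Proof.
have gi : 0 < 1 - gamma by rewrite subr_gt0.
elim: t s => [|t IH] s tT; first exact: hV0.
have {}IH s' := IH s' (ltnW tT).
have [e0 e1] := andP (heta (tT : (0 < t.+1 <= T)%N)).
have [a0 a1] := andP (IH s); have [b0 b1] := andP (IH (samples w t s)).
have [r0 r1] := andP (hr s).
rewrite /V /= -/(V w t s) -/(V w t (samples w t s)).
move: a0 a1 b0 b1; set a := V w t s; set b := V w t _; set h := 1 / (1 - gamma).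
(* The interval from 0 to [h] is stable: the new target stays in it, and the update is a convex
   combination. *)
have eh : 1 + gamma * h = h by rewrite /h; field; exact: lt0r_neq0.
move=> a0 a1 b0 b1.
have c0 : 0 <= gamma * b by rewrite mulr_ge0 // ltW.
have c1 : gamma * b <= gamma * h by rewrite ler_wpM2l // ltW.
apply/andP; split.
  by apply: addr_ge0; apply: mulr_ge0 => //; lra.
have : (1 - eta t.+1) * a <= (1 - eta t.+1) * h by apply: ler_wpM2l => //; lra.
have : eta t.+1 * (r s + gamma * b) <= eta t.+1 * h by apply: ler_wpM2l => //; lra.
lra.
Qed.

Lemma td_error_bound w t s : (t <= T)%N -> `|td_error w t s| <= 1 / (1 - gamma).
Proof.
move=> tT; have [a0 a1] := andP (td_bound w s tT).
have [b0 b1] := andP (Vstar_bound kP hr g0 g1 s).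
by rewrite ler_norml /td_error /Vs; apply/andP; split; lra.
Qed.

(** Subtracting the Bellman equation from the update isolates the last summand, which is centered
    given the past. *)
Lemma td_errorS w (t : 'I_T) s :
  td_error w t.+1 s = (1 - eta t.+1) * td_error w t s
    + eta t.+1 * gamma * Pop P (td_error w t) s
    + eta t.+1 * gamma * (V w t (w t s) - Pop P (V w t) s).
Proof.
have eB : Vs s = r s + gamma * Pop P Vs s := Vstar_Bellman kP hr g0 g1 s.
have -> : Pop P (td_error w t) s = Pop P (V w t) s - Pop P Vs s.
  rewrite -[- Pop P Vs s]mulN1r -PopZ -PopD.
  by apply: eq_Pop => s'; rewrite mulN1r.
rewrite /td_error {1}/V /= samples_ord -/(V w t s) -/(V w t (w t s)).
rewrite [in LHS]eB; ring: eB.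
Qed.

Definition push p s' : R := \sum_s p s * P s s'.

Lemma sum_push p f : \sum_s push p s * f s = \sum_s p s * Pop P f s.
Proof.
rewrite (eq_bigr (fun s' => \sum_s p s * P s s' * f s')); last first.
  by move=> s' _; rewrite /push mulr_suml.
rewrite exchange_big /=; apply: eq_bigr => s _; rewrite /Pop mulr_sumr.
by apply: eq_bigr => s' _; rewrite mulrA.
Qed.

(** The adjoint of the mean part of the recursion: its pairing with the error at [t - 1] is the
    conditional mean of the pairing of [p] with the error at [t]. *)
Definition pull t p s : R := (1 - eta t) * p s + eta t * gamma * push p s.

Lemma sum_pull t p f : \sum_s pull t p s * f s =
  \sum_s p s * ((1 - eta t) * f s + eta t * gamma * Pop P f s).
Proof.
rewrite (eq_bigr (fun s => (1 - eta t) * (p s * f s) + eta t * gamma * (push p s * f s))).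
  rewrite big_split /= -!mulr_sumr sum_push !mulr_sumr -big_split /=.
  by apply: eq_bigr => s _; ring.
by move=> s _; rewrite /pull; ring.
Qed.

Lemma pull_ge0 t p s : (0 < t <= T)%N -> (forall s, 0 <= p s) -> 0 <= pull t p s.
Proof.
move=> /heta /andP[e0 e1] p0; apply: addr_ge0; apply: mulr_ge0 => //.
- lra.
- by rewrite mulr_ge0 // ltW.
- by apply: sumr_ge0 => s' _; rewrite mulr_ge0 //; case: kP.
Qed.

(** The rows of [P] sum to 1. This loss of mass is what makes the initial error decay. *)
Lemma pull_mass t p : \sum_s pull t p s = (1 - eta t * (1 - gamma)) * \sum_s p s.
Proof.
transitivity (\sum_s pull t p s * (fun=> 1) s); first by under [RHS]eq_bigr do rewrite mulr1.
rewrite sum_pull mulr_sumr; apply: eq_bigr => s _; rewrite Pop_cst //; ring.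
Qed.

(** Plays the part of a stopping time: its indicator inside the mean gives access to the variance
    bound. The end [t] is excluded, so [calm B t0 t.+1] is decided by the coordinates before [t]. *)
Definition calm (B : R) (t0 t : nat) w : bool :=
  all (fun k => [forall s, `|td_error w k s| <= B]) (index_iota t0 t).

Lemma calmP B t0 t w :
  reflect (forall k s, (t0 <= k < t)%N -> `|td_error w k s| <= B) (calm B t0 t w).
Proof.
apply: (iffP allP) => [h k s kt|h k].
  by have := h k; rewrite mem_index_iota => /(_ kt) /forallP; apply.
by rewrite mem_index_iota => kt; apply/forallP => s; exact: h.
Qed.

Lemma td_error_resample w (t : 'I_T) x k s : (k <= t)%N ->
  td_error (resample t x w) k s = td_error w k s.
Proof. by move=> kt; rewrite /td_error /V td_resample. Qed.

Lemma calm_resample B t0 w (t : 'I_T) x :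
  calm B t0 t.+1 (resample t x w) = calm B t0 t.+1 w.
Proof.
apply: eq_in_all => k; rewrite mem_index_iota ltnS => /andP[_ kt].
by apply: eq_forallb => s; rewrite td_error_resample.
Qed.

(** * Exponential moment of the error on the calm event *)

Section KilledMgf.
Variables (B etab rho lam : R) (t0 : nat).
Hypothesis (hetab : forall t, (t0 < t <= T)%N -> eta t <= etab).
Hypothesis (hrho : forall t, (t0 < t <= T)%N -> 1 - eta t * (1 - gamma) <= rho).
Hypotheses (etab0 : 0 <= etab) (rho0 : 0 <= rho).
Hypothesis (hlam : `|lam| * gamma * etab / (1 - gamma) <= 1 / 2).

Let W := budget P r gamma B.

(** Given the past, the exponent is its conditional mean plus independent centered noises of weight
    [a s]. Calmness bounds their variances, and the drift of the budget dominates these. *)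
Lemma conditional_mgf_le p w (t : 'I_T) : (t0 <= t)%N -> (forall s, 0 <= p s <= 1) ->
  calm B t0 t.+1 w ->
  \sum_x step_weight P x * expR (lam * \sum_s p s * td_error (resample t x w) t.+1 s)
  <= expR (lam * \sum_s pull t.+1 p s * td_error w t s)
     * expR (2 * etab * lam ^+ 2 * (eta t.+1 * \sum_s p s * (W s - gamma * Pop P W s))).
Proof.
move=> t0t hp /calmP hc.
have gi : 0 < 1 - gamma by rewrite subr_gt0.
have tT : (t.+1 <= T)%N by exact: ltn_ord.
have [e0 e1] := andP (heta (tT : (0 < t.+1 <= T)%N)).
have eb : eta t.+1 <= etab by apply: hetab; rewrite ltnS t0t.
pose a s := lam * (eta t.+1 * gamma * p s).
have split_exp x : lam * (\sum_s p s * td_error (resample t x w) t.+1 s) =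
    lam * (\sum_s pull t.+1 p s * td_error w t s)
    + \sum_s a s * (V w t (x s) - Pop P (V w t) s).
  rewrite sum_pull !mulr_sumr -big_split /=; apply: eq_bigr => s _.
  have eV k s' : (k <= t)%N -> V (resample t x w) k s' = V w k s'.
    by move=> kt; rewrite /V td_resample.
  rewrite td_errorS td_error_resample // ffunE eqxx eV //.
  rewrite (eq_Pop _ _ (fun s' => td_error_resample w x s' (leqnn t))).
  rewrite (eq_Pop _ _ (fun s' => eV t s' (leqnn t))) /a; ring.
under eq_bigr do rewrite split_exp expRD mulrCA.
rewrite -mulr_sumr ler_pM2l ?expR_gt0 //.
apply: le_trans (step_mgf_le kP _) _.
  (* The weight is at most [|lam| gamma etab] and the noise at most [1 / (1 - gamma)], so [hlam] is
     the bound 1/2 needed here. *)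
  move=> s s'; apply: le_trans (ler_norm _) _; rewrite normrM.
  apply: le_trans hlam; apply: ler_pM => //.
    have [p0 p1] := andP (hp s).
    have ep0 : 0 <= eta t.+1 * p s by exact: mulr_ge0.
    have -> : a s = lam * (gamma * (eta t.+1 * p s)) by rewrite /a; ring.
    rewrite normrM -mulrA ler_wpM2l // ger0_norm ?mulr_ge0 ?(ltW g0) //.
    by rewrite ler_wpM2l ?(ltW g0) // -[etab]mulr1 ler_pM.
  have q0 : 0 <= Pop P (V w t) s <= 1 / (1 - gamma).
    apply/andP; split.
      by apply: Pop_ge0 => // u; case/andP: (td_bound w u (ltnW tT)).
    rewrite -[leRHS](@Pop_cst _ _ P _ s kP); apply: Pop_le => // u.
    by case/andP: (td_bound w u (ltnW tT)).
  have [q1 q2] := andP q0; have [q3 q4] := andP (td_bound w s' (ltnW tT)).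
  by rewrite -div1r ler_norml; apply/andP; split; lra.
rewrite ler_expR mulr_sumr !mulr_sumr; apply: ler_sum => s _.
have [p0 p1] := andP (hp s).
have hv : Pvar P (V w t) s <= 2 * Pvar P Vs s + 2 * B ^+ 2.
  have -> : Pvar P (V w t) s = Pvar P (fun s => Vs s + td_error w t s) s.
    by congr Pvar; apply/funext => u; rewrite /td_error; ring.
  apply: le_trans (PvarD_le _ _ _ kP) _; rewrite lerD2l ler_pM2l //.
  by apply: Pvar_le => // u; apply: hc; rewrite t0t /=.
have hd := budget_drift B kP hr g0 g1 s; rewrite -/W -/Vs in hd.
have hvW : gamma ^+ 2 * Pvar P (V w t) s <= W s - gamma * Pop P W s.
  by apply: le_trans hd; rewrite ler_wpM2l // sqr_ge0.
have hv0 : 0 <= gamma ^+ 2 * Pvar P (V w t) s.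
  by rewrite mulr_ge0 ?sqr_ge0 // Pvar_ge0.
(* One of the two factors [eta p_s] is bounded by [etab]; the other stays linear in [p], which lets
   the budget telescope. *)
have -> : 2 * (a s ^+ 2 * Pvar P (V w t) s) =
  2 * lam ^+ 2 * ((eta t.+1 * p s) * (eta t.+1 * p s)) * (gamma ^+ 2 * Pvar P (V w t) s).
  by rewrite /a; ring.
have -> : 2 * etab * lam ^+ 2 * (eta t.+1 * (p s * (W s - gamma * Pop P W s))) =
  2 * lam ^+ 2 * (etab * (eta t.+1 * p s)) * (W s - gamma * Pop P W s) by ring.
have ep0 : 0 <= eta t.+1 * p s by exact: mulr_ge0.
have l0 : 0 <= 2 * lam ^+ 2 by apply: mulr_ge0 => //; exact: sqr_ge0.
apply: ler_pM => //; first by apply: mulr_ge0 => //; exact: mulr_ge0.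
apply: ler_wpM2l => //; apply: ler_wpM2r => //.
by rewrite -[etab]mulr1 ler_pM.
Qed.

(* The bound is for every nonnegative p at once: one step turns p into
   pull p and the drift of the budget pays for the conditional variance. *)
Lemma killed_mgf_le p t : (t0 <= t <= T)%N -> (forall s, 0 <= p s) -> \sum_s p s <= 1 ->
  mean P (fun w => (calm B t0 t w)%:R * expR (lam * \sum_s p s * td_error w t s)) <=
  expR (`|lam| * (rho ^+ (t - t0) * \sum_s p s) / (1 - gamma)
        + 2 * etab * lam ^+ 2 * \sum_s p s * W s).
Proof.
have gi : 0 < 1 - gamma by rewrite subr_gt0.
(* At time [t0] the error is only known to be at most [1 / (1 - gamma)], and the budget term is
   nonnegative. *)
have base q : (t0 <= T)%N -> (forall s, 0 <= q s) ->
    mean P (fun w => (calm B t0 t0 w)%:R * expR (lam * \sum_s q s * td_error w t0 s)) <=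
    expR (`|lam| * (rho ^+ (t0 - t0) * \sum_s q s) / (1 - gamma)
        + 2 * etab * lam ^+ 2 * \sum_s q s * W s).
  move=> tT q0; rewrite -[leRHS](mean_cst T kP); apply: mean_le => // w.
  rewrite subnn expr0 mul1r -[leRHS]mul1r ler_pM ?expR_ge0 //; first by case: (calm _ _ _ _).
  rewrite ler_expR -[leLHS]addr0 lerD //.
    apply: le_trans (ler_norm _) _; rewrite normrM -mulrA ler_wpM2l // mulr_suml.
    apply: le_trans (ler_norm_sum _ _ _) _; apply: ler_sum => s _.
    by rewrite normrM (ger0_norm (q0 s)) ler_wpM2l // -div1r td_error_bound.
  apply: mulr_ge0; first by apply: mulr_ge0; [exact: mulr_ge0 | exact: sqr_ge0].
  apply: sumr_ge0 => s _; apply: mulr_ge0 => //.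
  by case/andP: (budget_bound B kP hr g0 g1 s).
move=> /andP[]; elim: t p => [|t IH] p; last rewrite leq_eqVlt => /predU1P[et|lt].
- by rewrite leqn0 => /eqP e tT p0 _; move: base tT; rewrite e => base tT; exact: base.
- by rewrite -et => tT p0 _; exact: base.
- move=> tT p0 p1; rewrite ltnS in lt.
  pose i := Ordinal tT; have it : nat_of_ord i = t by [].
  have p01 s : 0 <= p s <= 1.
    rewrite p0 /=; apply: le_trans p1; rewrite (bigD1 s) //= lerDl.
    by apply: sumr_ge0.
  have [e0 e1] := andP (heta (tT : (0 < t.+1 <= T)%N)).
  have hm := pull_mass t.+1 p.
  have m0 : 0 <= \sum_s p s by exact: sumr_ge0.
  have c01 : 0 <= 1 - eta t.+1 * (1 - gamma) <= 1.
    rewrite subr_ge0 lerBlDl lerDr mulr_ge0 ?(ltW gi) // andbT.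
    by apply: mulr_ile1 => //; rewrite ?(ltW gi) // lerBlDl lerDr ltW.
  have [c0 c1] := andP c01.
  rewrite (mean_resample kP i).
  pose K := 2 * etab * lam ^+ 2 * (eta t.+1 * \sum_s p s * (W s - gamma * Pop P W s)).
  apply: (@le_trans _ _ (mean P (fun w =>
     ((calm B t0 t w)%:R * expR (lam * \sum_s pull t.+1 p s * td_error w t s)) * expR K))).
    apply: mean_le => // w.
    under eq_bigr => x _ do rewrite -[t.+1]/(i.+1) calm_resample mulrCA.
    rewrite -mulr_sumr -mulrA.
    have [hc|_] := boolP (calm B t0 i.+1 w); last first.
      by rewrite mul0r !mulr_ge0 ?expR_ge0.
    have -> : calm B t0 t w.
      apply/calmP => k s /andP[k0 kt]; move/calmP: hc; apply.
      by rewrite k0 ltnS ltnW.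
    rewrite !mul1r; exact: (@conditional_mgf_le p w i).
  rewrite meanZr.
  apply: (@le_trans _ _ (expR (`|lam| * (rho ^+ (t - t0) * \sum_s pull t.+1 p s) / (1 - gamma)
        + 2 * etab * lam ^+ 2 * \sum_s pull t.+1 p s * W s) * expR K)).
    rewrite ler_wpM2r ?expR_ge0 // IH // ?(ltnW tT) //.
      by move=> s; exact: pull_ge0.
    by rewrite hm; apply: mulr_ile1.
  rewrite -expRD ler_expR -addrA lerD //.
    rewrite ler_wpM2r ?invr_ge0 ?(ltW gi) // ler_wpM2l // subSn // exprS hm.
    rewrite [rho * _]mulrC -[leRHS]mulrA ler_wpM2l ?exprn_ge0 // ler_wpM2r // hrho //.
    by rewrite ltnS lt.
  (* Exact telescoping: the budget paired with [pull t.+1 p], plus [eta] times its drift paired with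
     [p], is the budget paired with [p]. *)
  rewrite /K -mulrDr le_eqVlt; apply/orP; left; apply/eqP; congr (_ * _).
  rewrite sum_pull mulr_sumr -big_split /=; apply: eq_bigr => s _; ring.
Qed.
End KilledMgf.

(** Chernoff's bound for the point mass at [s] and both signs of [lam = L / y]. The margin [2 y]
    contributes [2 L] to the exponent; the variance term uses at most [L] of it. *)
Lemma calm_tail_le B etab rho t0 t s y L :
  (forall t, (t0 < t <= T)%N -> eta t <= etab) ->
  (forall t, (t0 < t <= T)%N -> 1 - eta t * (1 - gamma) <= rho) ->
  0 <= etab -> 0 <= rho -> (t0 <= t <= T)%N -> 0 < y -> 0 <= L ->
  L * (4 * etab * (1 / (1 - gamma) ^+ 2 + B ^+ 2 / (1 - gamma))) <= y ^+ 2 ->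
  L / y * gamma * etab / (1 - gamma) <= 1 / 2 ->
  prob P (fun w => calm B t0 t w &&
    (rho ^+ (t - t0) / (1 - gamma) + 2 * y < `|td_error w t s|)) <= 2 * expR (- L).
Proof.
move=> hetab hrho etab0 rho0 t0t y0 L0 hQ hlam.
have gi : 0 < 1 - gamma by rewrite subr_gt0.
set x := _ + 2 * y.
pose lam := L / y; have lam0 : 0 <= lam by rewrite divr_ge0 // ltW.
pose p s' : R := (s' == s)%:R.
have sum_p f : \sum_s' p s' * f s' = f s.
  rewrite (bigD1 s) //= /p eqxx mul1r big1 ?addr0 // => s' /negPf ->.
  by rewrite mul0r.
have p1 : \sum_s' p s' = 1 by under eq_bigr do rewrite -[p _]mulr1; rewrite (sum_p (fun=> 1)).
have one_sided l : `|l| = lam ->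
    mean P (fun w => (calm B t0 t w)%:R * expR (l * td_error w t s)) * expR (- (lam * x))
    <= expR (- L).
  move=> hl.
  have := @killed_mgf_le B etab rho l t0 hetab hrho etab0 rho0 _ p t t0t.
  rewrite hl p1 (sum_p (budget _ _ _ _)) => /(_ hlam (fun=> ler0n _ _) (lexx _)) h.
  rewrite -ler_pdivlMr ?expR_gt0 //; apply: le_trans (le_trans h _).
    by apply: (mean_le kP) => w; rewrite sum_p.
  rewrite -expRN -expRD ler_expR opprK.
  have [_ hW] := andP (budget_bound B kP hr g0 g1 s).
  have ely : lam * y = L by rewrite /lam divfK // gt_eqF.
  have hk : lam ^+ 2 * (4 * etab * (1 / (1 - gamma) ^+ 2 + B ^+ 2 / (1 - gamma))) <= L.
    have [L_eq0|Ln0] := eqVneq L 0; first by rewrite /lam L_eq0 mul0r expr0n mul0r.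
    have Lp : 0 < L by rewrite lt_neqAle eq_sym Ln0.
    have : lam ^+ 2 * (L * (4 * etab * (1 / (1 - gamma) ^+ 2 + B ^+ 2 / (1 - gamma))))
      <= lam ^+ 2 * y ^+ 2 by rewrite ler_wpM2l // sqr_ge0.
    by rewrite -exprMn ely mulrCA expr2 ler_pM2l.
  have hb : 2 * etab * lam ^+ 2 * budget P r gamma B s <=
      2 * etab * lam ^+ 2 * (2 / (1 - gamma) ^+ 2 + 2 * B ^+ 2 / (1 - gamma)).
    by rewrite ler_wpM2l // mulr_ge0 ?sqr_ge0 // mulr_ge0.
  have ex : lam * x = lam * (rho ^+ (t - t0) * 1) / (1 - gamma) + 2 * L.
    by rewrite /x -ely; ring.
  have hbe : 2 * etab * lam ^+ 2 * (2 / (1 - gamma) ^+ 2 + 2 * B ^+ 2 / (1 - gamma))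
      = lam ^+ 2 * (4 * etab * (1 / (1 - gamma) ^+ 2 + B ^+ 2 / (1 - gamma))) by ring.
  rewrite hbe in hb; have {}hb := le_trans hb hk.
  have l2 : l ^+ 2 = lam ^+ 2 by rewrite -hl real_normK ?num_real.
  rewrite ex l2; lra.
have pos := one_sided lam (ger0_norm lam0).
have neg := one_sided (- lam) (etrans (normrN _) (ger0_norm lam0)).
apply: (@le_trans _ _ (expR (- L) + expR (- L))); last by lra.
apply: le_trans (lerD pos neg); rewrite prob_mean -!meanZr
  /mean -big_split /=; apply: ler_sum => w _; rewrite -mulrDr ler_wpM2l ?weight_ge0 //.
have [_|_] := boolP (calm _ _ _ _); last by rewrite !mul0r addr0.
rewrite !mul1r /= -!expRD; case: ltP => [hx|_]; last by rewrite addr_ge0 ?expR_ge0.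
move: hx; rewrite lter_normr => /orP[] hx.
  rewrite -[leLHS]addr0 lerD ?expR_ge0 // -expR0 ler_expR -mulrBr.
  by rewrite mulr_ge0 // subr_ge0 ltW.
rewrite -[leLHS]add0r lerD ?expR_ge0 // -expR0 ler_expR mulNr -mulrN -mulrBr.
by rewrite mulr_ge0 // subr_ge0 ltW.
Qed.

End TailBound.

(** * Union bound over the two rounds *)

Lemma prob_le (R : realType) (S : finType) (P : S -> S -> R) T
    (E F : pred (sample_space S T)) : is_kernel P ->
  (forall w, E w -> F w) -> prob P E <= prob P F.
Proof.
move=> kP EF; rewrite !prob_mean; apply: mean_le => // w.
by rewrite ler_nat; case: (E w) (EF w) => // ->.
Qed.

(** If the final error exceeds [eps], either the error stays below [D] on the last stretch and
    [bad2] occurs, or it exceeds [D] at some time there and [bad1] occurs. This makes at most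
    [T + 1] events per state. *)
Lemma two_round_bound (R : realType) (S : finType) (P : S -> S -> R) (r V0 : S -> R)
    (gamma : R) (eta : nat -> R) (T m : nat) (etab rho D eps L : R) :
  is_kernel P -> (forall s, 0 <= r s <= 1) -> 0 < gamma -> gamma < 1 ->
  (forall s, 0 <= V0 s <= 1 / (1 - gamma)) ->
  (forall t, (0 < t <= T)%N -> 0 <= eta t <= 1) ->
  (3 * m <= T)%N ->
  (forall t, (m < t <= T)%N -> eta t <= etab) ->
  (forall t, (m < t <= T)%N -> 1 - eta t * (1 - gamma) <= rho) ->
  0 <= etab -> 0 <= rho <= 1 -> 0 <= L -> 0 < D -> 0 < eps ->
  rho ^+ m / (1 - gamma) <= D / 2 -> rho ^+ m / (1 - gamma) <= eps / 2 ->
  L * (4 * etab * (1 / (1 - gamma) ^+ 2 + (1 / (1 - gamma)) ^+ 2 / (1 - gamma)))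
    <= (D / 4) ^+ 2 ->
  L * (4 * etab * (1 / (1 - gamma) ^+ 2 + D ^+ 2 / (1 - gamma))) <= (eps / 4) ^+ 2 ->
  L / (D / 4) * gamma * etab / (1 - gamma) <= 1 / 2 ->
  L / (eps / 4) * gamma * etab / (1 - gamma) <= 1 / 2 ->
  1 - T.+1%:R * (#|S|%:R * (2 * expR (- L))) <=
  prob P (fun w : sample_space S T =>
    [forall s, `|td r gamma eta (samples w) V0 T s - Vstar P r gamma s| <= eps]).
Proof.
move=> kP hr g0 g1 hV0 heta mT hetab hrho etab0 /andP[rho0 rho1] L0 D0 eps0.
move=> decD deceps QD Qeps lamD lameps.
have gi : 0 < 1 - gamma by rewrite subr_gt0.
pose calm' := calm P r V0 gamma eta (T := T).
pose err := td_error P r V0 gamma eta (T := T).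
pose bad1 t s (w : sample_space S T) := calm' (1 / (1 - gamma)) m t w && (D < `|err w t s|).
pose bad2 s (w : sample_space S T) := calm' D (2 * m)%N T w && (eps < `|err w T s|).
(* Half of the target [e] absorbs the decayed initial error, the other half is the deviation
   [2 (e / 4)]. *)
have decay k e : (m <= k)%N -> rho ^+ m / (1 - gamma) <= e / 2 ->
    rho ^+ k / (1 - gamma) + 2 * (e / 4) <= e.
  move=> mk he; have : rho ^+ k / (1 - gamma) <= rho ^+ m / (1 - gamma).
    by rewrite ler_wpM2r ?invr_ge0 ?(ltW gi) // ler_wiXn2l.
  lra.
have p1 t s : (2 * m <= t < T)%N -> prob P (bad1 t s) <= 2 * expR (- L).
  move=> /andP[mt tT].
  have [mtm mtT] : (m <= t - m)%N /\ (m <= t <= T)%N by move: mt tT; clear; lia.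
  apply: le_trans (calm_tail_le kP hr g0 g1 hV0 heta s hetab hrho etab0 rho0
    (_ : (m <= t <= T)%N) (_ : 0 < D / 4) L0 QD lamD).
  - apply: prob_le => // w /andP[hc hD]; apply/andP; split=> //.
    by apply: le_lt_trans hD; exact: decay.
  - exact: mtT.
  - by rewrite divr_gt0.
have m2T : (m <= T - 2 * m)%N /\ (2 * m <= T)%N by move: mT; clear; lia.
have late t : (2 * m < t <= T)%N -> (m < t <= T)%N by clear; lia.
have p2 s : prob P (bad2 s) <= 2 * expR (- L).
  apply: le_trans (@calm_tail_le _ _ P r V0 gamma eta T kP hr g0 g1 hV0 heta D etab rho
    (2 * m)%N T s (eps / 4) L _ _ etab0 rho0 _ _ L0 Qeps lameps).
  - apply: prob_le => // w /andP[hc hD]; apply/andP; split=> //.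
    by apply: le_lt_trans hD; apply: decay => //; case: m2T.
  - by move=> t /late; exact: hetab.
  - by move=> t /late; exact: hrho.
  - by rewrite leqnn andbT; case: m2T.
  - by rewrite divr_gt0.
rewrite lerBlDr -[leLHS](mean_cst T kP) prob_mean.
apply: (@le_trans _ _ (mean P (fun w : sample_space S T =>
  ([forall s, `|td r gamma eta (samples w) V0 T s - Vstar P r gamma s| <= eps])%:R
  + (\sum_(2 * m <= t < T) \sum_s (bad1 t s w)%:R + \sum_s (bad2 s w)%:R)))).
  apply: mean_le => // w.
  have s1 : 0 <= \sum_(2 * m <= t < T) \sum_s ((bad1 t s w)%:R : R).
    by apply: sumr_ge0 => t _; apply: sumr_ge0 => s _.
  have s2 : 0 <= \sum_s ((bad2 s w)%:R : R) by apply: sumr_ge0 => s _.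
  case: forallP => [_|/existsNP [s /negP]]; first by rewrite lerDl addr_ge0.
  rewrite -ltNge add0r => hs.
  have [hc|] := boolP (calm' D (2 * m)%N T w).
    rewrite -[leLHS]add0r lerD // (bigD1 s) //= /bad2 hc /err /td_error hs lerDl.
    by apply: sumr_ge0.
  case/allPn => k; rewrite mem_index_iota => mk /forallPn /= [u]; rewrite -ltNge => hu.
  rewrite -[leLHS]addr0 lerD //.
  have b1 : bad1 k u w.
    (* In the first round calmness is automatic, by the a priori bound on the error. *)
    rewrite /bad1 /err hu andbT; suff -> : calm' (1 / (1 - gamma)) m k w by [].
    apply/calmP => j v hj; apply: td_error_bound => //; move: mk hj; clear; lia.
  have kin : k \in index_iota (2 * m) T by rewrite mem_index_iota.
  rewrite (bigD1_seq k) ?iota_uniq //= -[leLHS]addr0 lerD //.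
    by rewrite (bigD1 u) //= b1 lerDl sumr_ge0.
  by apply: sumr_ge0 => t _; apply: sumr_ge0.
rewrite /mean; under eq_bigr do rewrite mulrDr; rewrite big_split /= lerD2l.
under eq_bigr do rewrite mulrDr; rewrite big_split /= -natr1 mulrDl mul1r.
have cS : \sum_(s : S) (2 * expR (- L)) = #|S|%:R * (2 * expR (- L)).
  by rewrite sumr_const [RHS]mulr_natl.
apply: lerD; last first.
  under eq_bigr do rewrite mulr_sumr; rewrite exchange_big /= -cS.
  by apply: ler_sum => s _; apply: le_trans (p2 s); rewrite prob_mean.
under eq_bigr do rewrite mulr_sumr; rewrite exchange_big /=.
apply: (@le_trans _ _ (\sum_(2 * m <= t < T) (#|S|%:R * (2 * expR (- L))))).
  rewrite !big_nat; apply: ler_sum => t mt; rewrite -cS.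
  under eq_bigr do rewrite mulr_sumr; rewrite exchange_big /=.
  by apply: ler_sum => s _; apply: le_trans (p1 t s mt); rewrite prob_mean.
rewrite sumr_const_nat [leRHS]mulr_natl ler_wpMn2l ?leq_subr //.
Qed.

(** * Numerical conditions on the step sizes and the horizon *)

Lemma ln2_ge_half (R : realType) : 1 / 2 <= ln (2 : R).
Proof.
rewrite -ler_expR lnK ?posrE //.
have -> : 1 / 2 = - (- (1 / 2)) :> R by rewrite opprK.
rewrite expRN -[leRHS]invrK lef_pV2 ?posrE ?expR_gt0 //.
have := expR_ge1Dx (- (1 / 2) : R); lra.
Qed.

(** Everything follows from [L etab <= g ^ 2 M / 128]. The choice [D ^ 2 = M / g] balances the
    rounds: the first needs [(M / g) (1 + g) / 32 <= D ^ 2 / 16], the second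
    [(M + M ^ 2) / 32 <= eps ^ 2 / 16], where both [M] and [M ^ 2] are at most [eps ^ 2]. *)
Lemma two_round_conditions (R : realType) (gamma eps n l Lam c2 c3 etab : R) :
  let g := 1 - gamma in let M := Num.min eps (eps ^+ 2) in
  let L := 3 * Lam in let D := Num.sqrt (M / g) in
  0 < gamma -> gamma < 1 -> 0 < eps -> eps <= 1 / g -> 1 <= n -> 1 <= l -> 1 <= Lam ->
  0 < c2 -> 9 * 128 <= c2 * c3 -> 128 <= c3 ->
  c3 * l ^+ 3 * Lam <= n * g ^+ 3 * M ->
  etab = 3 * l ^+ 2 / (c2 * g * n) ->
  [/\ 0 < D, n^-1 / g <= D / 2 & n^-1 / g <= eps / 2] /\
  [/\ L * (4 * etab * (1 / g ^+ 2 + (1 / g) ^+ 2 / g)) <= (D / 4) ^+ 2,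
      L * (4 * etab * (1 / g ^+ 2 + D ^+ 2 / g)) <= (eps / 4) ^+ 2,
      L / (D / 4) * gamma * etab / g <= 1 / 2 &
      L / (eps / 4) * gamma * etab / g <= 1 / 2].
Proof.
move=> g M L D gam0 gam1 eps0 epsg n1 l1 Lam1 c20 c23 c3l hn etabE.
have g0 : 0 < g by rewrite subr_gt0.
have g1 : g <= 1 by rewrite /g; lra.
have M0 : 0 < M by rewrite lt_min eps0 exprn_gt0.
have Meps : M <= eps by rewrite ge_min lexx.
have Meps2 : M <= eps ^+ 2 by rewrite ge_min lexx orbT.
have n0 : 0 < n by lra.
have epsg1 : g * eps <= 1 by rewrite mulrC -ler_pdivlMr.
have D2 : D ^+ 2 = M / g by rewrite sqr_sqrtr // divr_ge0 // ltW.
have D0 : 0 < D by rewrite sqrtr_gt0 divr_gt0.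
clearbody D M g.
have MD : M = D ^+ 2 * g by rewrite D2 divfK // gt_eqF.
have gM1 : g * M <= 1 by apply: le_trans epsg1; rewrite ler_pM2l.
have l2 : 1 <= l ^+ 2 by rewrite exprn_ege1.
have l3 : l ^+ 2 * Lam <= l ^+ 3 * Lam.
  by apply: ler_wpM2r; [lra | exact: ler_weXn2l].
have lL : 1 <= l ^+ 2 * Lam by rewrite -[1]mulr1 ler_pM.
have c30 : 0 < c3 by lra.
have ngM : c3 <= n * g ^+ 3 * M.
  apply: le_trans hn; rewrite -mulrA -[leLHS]mulr1 ler_pM2l //; exact: le_trans l3.
(* The 9 in [9 * 128] is the 3 of [L] times the 3 of [etab]. *)
have Letab : L * etab <= g ^+ 2 * M / 128.
  rewrite etabE /L mulrA ler_pdivrMr; last by rewrite !mulr_gt0.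
  have h1 : c2 * (c3 * (l ^+ 3 * Lam)) <= c2 * (n * g ^+ 3 * M).
    by rewrite ler_pM2l // mulrA.
  have h2 : 9 * 128 * (l ^+ 2 * Lam) <= c2 * (c3 * (l ^+ 3 * Lam)).
    rewrite [leRHS]mulrA; apply: ler_pM => //.
    exact: le_trans lL.
  by move: h1 h2; clear; lra.
have LE0 : 0 <= L * etab.
  by rewrite etabE /L; rewrite mulr_ge0 ?divr_ge0 ?mulr_ge0 ?sqr_ge0 ?ltW //; lra.
have E32 z : 0 <= z -> L * (4 * etab * z) <= g ^+ 2 * M / 32 * z.
  move=> z0; have -> : L * (4 * etab * z) = 4 * (L * etab) * z by ring.
  by rewrite ler_wpM2r //; lra.
have gi : 0 <= g^-1 by rewrite invr_ge0 ltW.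
have ng2M : c3 <= n * g ^+ 2 * M.
  apply: le_trans ngM _; rewrite ler_pM2r // ler_pM2l //.
  by rewrite exprS ger_pMl // exprn_gt0.
have gne : g != 0 by rewrite gt_eqF.
have lamle y : 0 < y -> g * M <= 4 * y ->
    L / (y / 4) * gamma * etab / g <= 1 / 2.
  move=> y0 hy; have yne : y != 0 by rewrite gt_eqF.
  have -> : L / (y / 4) * gamma * etab / g = gamma * (4 * (L * etab) / (g * y)).
    by field; rewrite gne yne.
  rewrite -[leRHS]mul1r; apply: ler_pM; rewrite ?(ltW gam0) ?(ltW gam1) //.
    by apply: divr_ge0; apply: mulr_ge0 => //; exact: ltW.
  rewrite ler_pdivrMr ?mulr_gt0 //.
  have : g * (g * M) <= g * (4 * y) by rewrite ler_pM2l.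
  have : 0 <= g * y by rewrite mulr_ge0 // ltW.
  lra.
split; split.
- exact: D0.
- rewrite -invfM -div1r ler_pdivrMr ?mulr_gt0 //.
  (* Squaring removes the root in [D]. *)
  rewrite -(@ler_pXn2r _ 2) ?nnegrE ?mulr_ge0 ?divr_ge0 ?(ltW D0) ?(ltW n0) ?(ltW g0) //.
  have -> : (D / 2 * (n * g)) ^+ 2 = n * (n * g * M) / 4 by rewrite MD; field.
  have h : c3 <= n * g * M.
    apply: le_trans ng2M _; rewrite ler_pM2r // ler_pM2l // expr2 ger_pMl //.
  rewrite expr1n; have : 1 * c3 <= n * (n * g * M) by rewrite ler_pM //; lra.
  lra.
- rewrite -invfM -div1r ler_pdivrMr ?mulr_gt0 //.
  have h : n * g ^+ 2 * M <= n * g * eps.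
    apply: ler_pM => //; [by rewrite mulr_ge0 ?sqr_ge0 ?ltW | exact: ltW|].
    by rewrite ler_pM2l // expr2 ger_pMl.
  lra.
- apply: le_trans (E32 _ _) _.
    by apply: addr_ge0; apply: divr_ge0; rewrite ?sqr_ge0 ?ler01 ?(ltW g0).
  rewrite [leRHS]exprMn D2.
  have -> : g ^+ 2 * M / 32 * (1 / g ^+ 2 + (1 / g) ^+ 2 / g) = (M / g) * (1 + g) / 32.
    by field.
  have : 0 <= M / g by rewrite divr_ge0 // ltW.
  have : (M / g) * g <= (M / g) * 1 by rewrite ler_wpM2l // divr_ge0 // ltW.
  lra.
- apply: le_trans (E32 _ _) _.
    by apply: addr_ge0; apply: divr_ge0; rewrite ?sqr_ge0 ?ler01 ?(ltW g0).
  rewrite D2; have -> : g ^+ 2 * M / 32 * (1 / g ^+ 2 + M / g / g) = (M + M ^+ 2) / 32.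
    by field.
  have hM : M ^+ 2 <= eps ^+ 2 by rewrite !expr2; apply: ler_pM => //; exact: ltW.
  rewrite [leRHS]exprMn; lra.
- apply: lamle => //; rewrite MD.
  have gD : g * D <= 1.
    rewrite -(@ler_pXn2r _ 2) ?nnegrE ?mulr_ge0 ?(ltW D0) ?(ltW g0) // expr1n.
    by have -> : (g * D) ^+ 2 = g * M by rewrite MD; ring.
  have -> : g * (D ^+ 2 * g) = (g * D) * (g * D) by ring.
  have : (g * D) * (g * D) <= 1 * (g * D) by rewrite ler_pM2r ?mulr_gt0.
  have : g * D <= 1 * D by rewrite ler_pM2r.
  lra.
- apply: lamle => //.
  have : g * M <= 1 * eps by apply: ler_pM => //; exact: ltW.
  lra.
Qed.

Lemma rate_upper_bound (R : realType) (c2 g l : R) (T t : nat) :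
  0 < c2 -> 0 < g -> 0 < l -> (0 < T)%N -> (T %/ 3 < t)%N ->
  1 / (1 + c2 * g * t%:R / l ^+ 2) <= 3 * l ^+ 2 / (c2 * g * T%:R).
Proof.
move=> c20 g0 l0 T0 mt.
have Tt : (T <= 3 * t)%N by move: mt; clear; lia.
have t0 : (0 < t)%N by move: mt; clear; lia.
have hTt : T%:R <= 3 * t%:R :> R by rewrite -natrM ler_nat.
have l20 : 0 < l ^+ 2 by rewrite exprn_gt0.
have x0 : 0 < c2 * g * t%:R / l ^+ 2 by rewrite !mulr_gt0 ?ltr0n ?invr_gt0.
rewrite ler_pdivrMr; last by rewrite addr_gt0.
rewrite mulrAC ler_pdivlMr ?mulr_gt0 ?ltr0n // mul1r.
have -> : 3 * l ^+ 2 * (1 + c2 * g * t%:R / l ^+ 2) = 3 * l ^+ 2 + c2 * g * (3 * t%:R).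
  by field; rewrite gt_eqF.
have : c2 * g * T%:R <= c2 * g * (3 * t%:R) by rewrite ler_pM2l ?mulr_gt0.
have : 0 <= 3 * l ^+ 2 by rewrite mulr_ge0 ?ltW.
lra.
Qed.

(** With [x = c1 g T / l ^ 2 >= 1], the rate [1 / (1 + x)] is at least [1 / (2 x)]. Over
    [T %/ 3 >= T / 6] steps the exponent reaches [l ^ 2 / (12 c1)], which is at least [l = ln T]
    since [c1 <= 1 / 12]. *)
Lemma contraction_power_le (R : realType) (c1 g l : R) (T : nat) :
  0 < c1 -> c1 <= 1 / 12 -> 0 < g -> g <= 1 -> 1 <= l -> (8 <= T)%N ->
  l = ln T%:R -> l ^+ 2 <= c1 * g * T%:R ->
  let rho := 1 - 1 / (1 + c1 * g * T%:R / l ^+ 2) * g in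
  0 <= rho <= 1 /\ rho ^+ (T %/ 3)%N <= T%:R^-1.
Proof.
move=> c10 c1s g0 g1 l1 T8 lE hl rho.
have T0 : 0 < T%:R :> R by rewrite ltr0n; move: T8; clear; lia.
have l0 : 0 < l by lra.
have l20 : 0 < l ^+ 2 by rewrite exprn_gt0.
pose x := c1 * g * T%:R / l ^+ 2.
have x1 : 1 <= x by rewrite /x ler_pdivlMr // mul1r.
have e0 : 0 < 1 / (1 + x) by rewrite divr_gt0 //; lra.
have e1 : 1 / (1 + x) <= 1 by rewrite ler_pdivrMr; lra.
have rho0 : 0 <= rho.
  by rewrite subr_ge0; apply: mulr_ile1; rewrite ?(ltW e0) ?(ltW g0).
split; first by rewrite rho0 /= gerBl mulr_ge0 ?(ltW e0) ?(ltW g0).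
have eE : l ^+ 2 / (2 * c1 * g * T%:R) <= 1 / (1 + x).
  rewrite ler_pdivlMr; last by lra.
  have -> : l ^+ 2 / (2 * c1 * g * T%:R) * (1 + x) = (x^-1 + 1) / 2.
    by rewrite /x; field; rewrite !gt_eqF.
  have : x^-1 <= 1 by rewrite invf_le1 //; lra.
  lra.
have T6 : (T <= 6 * (T %/ 3))%N by move: T8; clear; lia.
have hm : T%:R <= 6 * (T %/ 3)%N%:R :> R by rewrite -natrM ler_nat.
set m := (T %/ 3)%N in hm *; have m0 : 0 <= m%:R :> R by exact: ler0n.
apply: (@le_trans _ _ (expR (- (1 / (1 + x) * g)) ^+ m)).
  by rewrite lerXn2r ?nnegrE ?expR_ge0 //; exact: expR_ge1Dx.
rewrite -expRM_natl -[leRHS](@lnK _ (T%:R^-1)) ?posrE ?invr_gt0 // lnV ?posrE //.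
rewrite -lE ler_expR mulrN lerN2.
have : l ^+ 2 / (2 * c1 * g * T%:R) * g * (T%:R / 6) <= 1 / (1 + x) * g * m%:R.
  apply: ler_pM.
  - by rewrite mulr_ge0 ?divr_ge0 ?mulr_ge0 ?ltW.
  - by rewrite divr_ge0 ?ltW.
  - by rewrite ler_pM2r.
  - by rewrite ler_pdivrMr; lra.
have -> : l ^+ 2 / (2 * c1 * g * T%:R) * g * (T%:R / 6) = l * (l / (12 * c1)).
  by field; rewrite !gt_eqF.
have : l * 1 <= l * (l / (12 * c1)).
  rewrite ler_pM2l // ler_pdivlMr; last by lra.
  lra.
rewrite mulr1 => h2 h1; rewrite [leRHS]mulrC; exact: le_trans h2 h1.
Qed.

(** A bootstrap: [ln T >= ln 2 >= 1 / 2] and [c3 l ^ 4 <= T g] give [T >= 128 / 16 = 8], whence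
    [ln T >= 3 ln 2 >= 1]. *)
Lemma horizon_large (R : realType) (c3 g M Lam : R) (T : nat) :
  let l := ln (T%:R : R) in
  (1 < T)%N -> 128 <= c3 -> 0 < g -> g <= 1 -> 0 < M -> g * M <= 1 -> l <= Lam ->
  c3 * l ^+ 3 * Lam <= T%:R * g ^+ 3 * M ->
  [/\ (8 <= T)%N, 1 <= l & c3 * l ^+ 2 <= T%:R * g].
Proof.
move=> l T1 c3s g0 g1 M0 gM lLam hT.
have T0 : 0 < T%:R :> R by rewrite ltr0n; move: T1; clear; lia.
have lh : 1 / 2 <= l.
  by apply: le_trans (ln2_ge_half R) _; rewrite ler_ln ?posrE // ler_nat.
have l0 : 0 < l by lra.
have g2 : g ^+ 3 * M <= g.
  have -> : g ^+ 3 * M = g * (g * (g * M)) by ring.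
  rewrite -[leRHS]mulr1 ler_pM2l // mulr_ile1 // ?ltW ?mulr_gt0 //.
have h1 : c3 * l ^+ 3 * Lam <= T%:R * g.
  by apply: le_trans hT _; rewrite -mulrA ler_pM2l.
have h2 : c3 * l ^+ 4 <= T%:R * g.
  apply: le_trans h1; rewrite exprSr mulrA ler_pM2l // mulr_gt0 ?exprn_gt0 //.
  exact: lt_le_trans c3s.
have h8 : (8 <= T)%N.
  rewrite -(ler_nat R).
  have a1 : (1 / 2) ^+ 4 <= l ^+ 4 by apply: lerXn2r => //; rewrite nnegrE; lra.
  have a2 : 128 * (1 / 2) ^+ 4 <= c3 * l ^+ 4.
    by apply: ler_pM => //; apply: exprn_ge0; lra.
  have a3 : T%:R * g <= T%:R * 1 by rewrite ler_pM2l.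
  have e8 : 8 = 128 * (1 / 2) ^+ 4 :> R by field.
  rewrite e8 -[leRHS]mulr1; exact: le_trans a2 (le_trans h2 a3).
have l1 : 1 <= l.
  have : ln ((2 : R) ^+ 3) <= l.
    by rewrite ler_ln ?posrE ?exprn_gt0 // -natrX ler_nat.
  rewrite lnXn //; have := ln2_ge_half R; lra.
split => //; apply: le_trans h2; rewrite ler_pM2l; last exact: lt_le_trans c3s.
by rewrite ler_weXn2l.
Qed.

(** * Choice of the constants and assembly *)

Theorem mainTheorem2 (R : realType) :
  exists c0 : R, 0 < c0 /\
  forall c1 c2 : R, 0 < c2 -> c2 <= c1 -> c1 <= c0 ->
  exists c3 : R, 0 < c3 /\
  forall (S : finType) (P : S -> S -> R) (r : S -> R)
         (gamma delta eps : R) (T : nat) (eta : nat -> R) (V0 : S -> R),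
    is_kernel P ->
    (forall s, 0 <= r s <= 1) ->
    0 < delta < 1 ->
    0 < gamma < 1 ->
    0 < eps <= 1 / (1 - gamma) ->
    (1 < T)%N ->
    (forall t : nat, (t <= T)%N ->
       1 / (1 + c1 * (1 - gamma) * T%:R / (ln (T%:R : R)) ^+ 2) <= eta t
       <= 1 / (1 + c2 * (1 - gamma) * t%:R / (ln (T%:R : R)) ^+ 2)) ->
    T%:R >= c3 * (ln (T%:R : R)) ^+ 3 * ln (#|S|%:R * T%:R / delta)
            / (gamma ^+ 2 * (1 - gamma) ^+ 3 * Num.min eps (eps ^+ 2)) ->
    (forall s, 0 <= V0 s <= 1 / (1 - gamma)) ->
    prob P (fun w : sample_space S T =>
      [forall s : S,
         `|td r gamma eta (samples w) V0 T s - Vstar P r gamma s| <= eps])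
    >= 1 - delta.
Proof.
(* The value required by [contraction_power_le]. *)
exists (1 / 12); split; first by lra.
move=> c1 c2 c20 c21 c1s; have c10 : 0 < c1 by lra.
(* The summands secure [c2 c3 >= 9 * 128] for the variances, [c1 c3 >= 1] for the contraction, and
   [c3 >= 128] for the horizon. *)
exists (9 * 128 * (c2^-1 + c1^-1) + 128); set c3 := _ + 128.
have ci1 : 0 < c1^-1 by rewrite invr_gt0.
have ci2 : 0 < c2^-1 by rewrite invr_gt0.
have c3s : 128 <= c3 by rewrite /c3; lra.
have c13 : 1 <= c1 * c3.
  have -> : c1 * c3 = 9 * 128 * (c1 * c2^-1 + 1) + 128 * c1.
    by rewrite /c3; field; rewrite !gt_eqF.
  by have := mulr_gt0 c10 ci2; lra.
have c23 : 9 * 128 <= c2 * c3.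
  have -> : c2 * c3 = 9 * 128 * (1 + c2 * c1^-1) + 128 * c2.
    by rewrite /c3; field; rewrite !gt_eqF.
  by have := mulr_gt0 c20 ci1; lra.
have c30 : 0 < c3 by lra.
clearbody c3; split=> // S P r gamma delta eps T eta V0.
move=> kP hr /andP[d0 d1] /andP[gam0 gam1] /andP[eps0 epsg] T1 heta hT hV0.
(* Without states the event is everything; otherwise the argument of the logarithm is positive. *)
have [S0|Sgt0] := posnP #|S|.
  rewrite prob_mean (_ : (fun w => _) = (fun=> 1)) ?mean_cst ?gerBl ?ltW //.
  apply/funext => w; case: forallP => // -[] s; exfalso.
  by have := card0_eq S0 s.
set g := 1 - gamma in heta hT epsg hV0 *.
set M := Num.min eps (eps ^+ 2) in hT.
set n : R := T%:R in heta hT *; set l := ln n in heta hT.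
set Lam := ln _ in hT.
have g0 : 0 < g by rewrite subr_gt0.
have g1 : g <= 1 by rewrite /g; lra.
have n1 : 1 <= n by rewrite ler1n; move: T1; clear; lia.
have n0 : 0 < n by lra.
have M0 : 0 < M by rewrite lt_min eps0 exprn_gt0.
have gM1 : g * M <= 1.
  have : g * eps <= 1 by rewrite mulrC -ler_pdivlMr.
  by apply: le_trans; rewrite ler_pM2l // ge_min lexx.
have z0 : 0 < #|S|%:R * n / delta by rewrite divr_gt0 // mulr_gt0 // ltr0n.
have nz : n <= #|S|%:R * n / delta.
  rewrite ler_pdivlMr // mulrC ler_pM2r //.
  by apply: le_trans (ltW d1) _; rewrite ler1n.
have lLam : l <= Lam by rewrite ler_ln ?posrE.
have l0 : 0 <= l by exact: ln_ge0.
have Lam0 : 0 <= Lam by exact: le_trans lLam.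
have hn : c3 * l ^+ 3 * Lam <= n * g ^+ 3 * M.
  move: hT; rewrite ler_pdivrMr ?mulr_gt0 ?exprn_gt0 // => /le_trans; apply.
  (* The factor [gamma ^ 2] is bounded by the inserted 1. *)
  have -> : n * g ^+ 3 * M = n * (1 * (g ^+ 3 * M)) by ring.
  rewrite ler_pM2l // -mulrA ler_pM2r ?mulr_gt0 ?exprn_gt0 //.
  by rewrite exprn_ile1 ?ltW.
have [T8 l1 hl] := horizon_large T1 c3s g0 g1 M0 gM1 lLam hn.
have hx : l ^+ 2 <= c1 * g * n.
  have : c1 * (c3 * l ^+ 2) <= c1 * (n * g) by rewrite ler_pM2l.
  have : 1 * l ^+ 2 <= (c1 * c3) * l ^+ 2 by rewrite ler_wpM2r ?sqr_ge0.
  rewrite mul1r [c1 * g * n]mulrAC -!mulrA; exact: le_trans.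
have [rho01 hrho] := contraction_power_le c10 c1s g0 g1 l1 T8 erefl hx.
set rho := 1 - _ in rho01 hrho.
have [[D0 dD deps] [QD Qeps lD leps]] := @two_round_conditions R gamma eps n l Lam c2 c3 _
  gam0 gam1 eps0 epsg n1 l1 (le_trans l1 lLam) c20 c23 c3s hn erefl.
have decay x : n^-1 / g <= x -> rho ^+ (T %/ 3)%N / g <= x.
  by apply: le_trans; rewrite ler_pM2r ?invr_gt0.
have eta01 t : (0 < t <= T)%N -> 0 <= eta t <= 1.
  move=> /andP[t0 tT]; have [h1 h2] := andP (heta t tT).
  have ge1 c k : 0 < c -> 0 <= k -> 1 <= 1 + c * g * k / l ^+ 2.
    move=> c_gt0 k0; rewrite lerDl; apply: divr_ge0; last exact: sqr_ge0.
    by apply: mulr_ge0 => //; apply: mulr_ge0; exact: ltW.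
  apply/andP; split.
    apply: le_trans h1; apply: divr_ge0 => //.
    by apply: le_trans (ge1 _ _ c10 (ltW n0)).
  apply: le_trans h2 _; have h := ge1 c2 t%:R c20 (ler0n _ _).
  by rewrite ler_pdivrMr ?mul1r // (lt_le_trans _ h).
apply: le_trans (two_round_bound kP hr gam0 gam1 hV0 eta01 _ _ _ _ rho01 _ D0 eps0
  (decay _ dD) (decay _ deps) QD Qeps lD leps).
(* As [L = 3 Lam], [expR (- L)] is [z ^ -3] with [z = |S| T / delta]. Since [delta z = |S| T] and
   [z >= T >= 2], the union bound [2 (T + 1) |S| / z ^ 3] is at most [delta]. *)
- rewrite lerD2l lerN2 expRN (@expRM_natl _ 3) /Lam lnK ?posrE //.
  set z := _ / delta in z0 nz *.
  have dz : delta * z = #|S|%:R * n by rewrite mulrC /z divfK // gt_eqF.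
  have -> : T.+1%:R * (#|S|%:R * (2 / z ^+ 3)) = #|S|%:R * (2 * (n + 1)) / z ^+ 3.
    by rewrite -natr1 -/n; ring.
  rewrite ler_pdivrMr ?exprn_gt0 // exprS [leRHS]mulrA dz -[leRHS]mulrA ler_pM2l ?ltr0n //.
  have n2 : 2 <= n by rewrite ler_nat.
  have : n * (2 * 2) <= n * z ^+ 2.
    by rewrite ler_pM2l // expr2; apply: ler_pM => //; exact: le_trans nz.
  by move: n2; clear; lra.
- by move: T8; clear; lia.
- move=> t /andP[mt tT]; have [_ h2] := andP (heta t tT); apply: le_trans h2 _.
  exact: (rate_upper_bound c20 g0 (lt_le_trans ltr01 l1) (ltnW T1) mt).
- move=> t /andP[_ tT]; have [h1 _] := andP (heta t tT).
  by rewrite /rho lerD2l lerN2 ler_pM2r.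
- apply: divr_ge0; apply: mulr_ge0 => //; try exact: sqr_ge0; try exact: ltW.
  by apply: mulr_ge0; exact: ltW.
- by apply: mulr_ge0.
Qed.
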